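(* Let $q$ be a square-free positive integer with $(q, 14) = 1$. Let $f_1, f_2, \ldots, f_9$ be nine real-valued functions on $\mathbb{Z}_q^{(3)}$. Then, for any $n \in \mathbb{Z}_q$, there exist $x_1, x_2, \ldots, x_9 \in \mathbb{Z}_q^{(3)}$ such that $n = x_1 + x_2 + \cdots + x_9$ in $\mathbb{Z}_q$ and $$\sum_{i=1}^9 f_i(x_i)\geq\frac{1}{\phi_3(q)}\sum_{a\in \mathbb{Z}_q^{(3)}}\sum_{i=1}^9 f_i(a).$$
   Context: For a positive integer $q$, $\mathbb{Z}_q=\mathbb{Z}/q\mathbb{Z}$ and $\mathbb{Z}_q^{\ast}=\{b\in\mathbb{Z}_q:(b,q)=1\}$. $\mathbb{Z}_q^{(3)}$ denotes the set of cubic residues in $\mathbb{Z}_q^\ast$, i.e. $\mathbb{Z}_q^{(3)}=\{x^3 : x\in\mathbb{Z}_q^\ast\}$, and $\phi_3(q)=|\mathbb{Z}_q^{(3)}|$. *)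

(* Defs.v *)
From mathcomp Require Import all_boot.

Set Implicit Arguments.
Unset Strict Implicit.
Unset Printing Implicit Defensive.

Definition squarefree (q : nat) : Prop := forall d : nat, d ^ 2 %| q -> d = 1.

(* Z/qZ is represented by its residues 0, ..., q - 1, that is by 'I_q, with
   equality in Z/qZ written as congruence mod q.  The ring 'Z_q is not used
   because 'Z_1 is Z/2Z, whereas q = 1 is allowed here: for q = 1 the residue 0
   is coprime to q, so both sets below are then all of Z/qZ = {0}. *)
Definition Zq_units (q : nat) : {set 'I_q} := [set b : 'I_q | coprime b q].

Definition cubic_residues (q : nat) : {set 'I_q} :=
  [set a : 'I_q | [exists b in Zq_units q, a == b ^ 3 %[mod q]]].

Definition phi3 (q : nat) : nat := #|cubic_residues q|.

(* Main.v *)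
Require Import Defs.
From mathcomp Require Import all_boot all_order all_algebra reals.
From mathcomp Require Import cyclic zify.

(** By the Chinese remainder theorem the cubic residues modulo [p * r], with [p]
    and [r] coprime, are the pairs of a cubic residue modulo [p] and one
    modulo [r]. The inequality passes to such a product ([balanced_mul]): solve
    the problem modulo [p] for the averages of the [f i] over the second
    coordinate, then, with the first coordinates fixed, solve it modulo [r]. As
    [q] is square-free, this leaves the case where [q] is a prime [p], different
    from 2 and 7.

    For a prime [p], let [A] be the set of cubic residues and [m] its
    cardinality. Let [v_i(k)] be the [k]-th largest value of [f i] on [A], and
    [X_i(k)] a set of [k] points of [A] where [f i] is at least [v_i(k)]
    ([top_sets]). Give the nine functions alternately the ranks [k] and
    [m + 1 - k], with five ranks [k] and four ranks [m + 1 - k]. The sizes of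
    the nine sets then add up to [4 (m + 1) + k], so by the Cauchy-Davenport
    theorem ([cauchy_davenport_iter]) every residue class is a sum of nine
    elements, one from each set, as soon as [4 (m + 1) + 1 >= p + 8], that is,
    [4 m >= p + 3]. The sum of the [f i] at these elements is at least the sum
    of the [v_i] at the chosen ranks. When [k] runs over 1, ..., [m], so does
    [m + 1 - k]; hence the average over [k] of the latter sum is exactly the
    required mean, and some [k] reaches it ([balanced_prime]).

    The bound [4 m >= p + 3] ([card_cubic_residues_large]) follows from
    [3 m >= p - 1] if [p >= 13], because a cube has at most three cube roots in
    a field. For the remaining primes 3, 5 and 11, the number [p - 1] is prime
    to 3, so that every unit is a cube and [m = p - 1]. *)

Set Implicit Arguments.
Unset Strict Implicit.
Unset Printing Implicit Defensive.

Import Order.TTheory GRing.Theory Num.Theory.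
Local Open Scope ring_scope.

(** * The Cauchy-Davenport theorem *)

Lemma translation_stable_full p (p_pr : prime p) (A : {set 'F_p}) (d : 'F_p) :
  d != 0 -> A != set0 -> (forall a, a \in A -> a + d \in A) -> A = [set: 'F_p].
Proof.
move=> d_neq0 /set0Pn[a aA] stabA; apply/setP=> y; rewrite inE.
have aMn_in (k : nat) : a + d *+ k \in A.
  elim: k => [|k IHk]; first by rewrite mulr0n addr0.
  by rewrite mulrSr addrA stabA.
have := aMn_in (d^-1 * (y - a) : 'F_p).
by rewrite -mulr_natr natr_Zp mulVKf // addrC subrK.
Qed.

(** By induction on the size of [B], with the Dyson transform: [A] and [B] are
    replaced by [A :|: (B + e)] and [B :&: (A - e)], which does not change the
    sum of the sizes and does not enlarge the sumset. If no [e] in [A - B] makes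
    [B] smaller, then [A] is stable under all differences of elements of [B]. *)
Lemma cauchy_davenport p (p_pr : prime p) (A B : {set 'F_p}) :
  A != set0 -> B != set0 ->
  (minn p (#|A| + #|B|).-1 <= #|[set (a + b)%R | a in A, b in B]|)%N.
Proof.
elim/ltn_ind: {B}#|B| {-2}B (erefl #|B|) A => m IHm B cardB A A0 B0.
have [/existsP[[[a b] b'] /and4P[/= aA bB b'B ab'A]] | stabA] :=
  boolP [exists t : 'F_p * 'F_p * 'F_p,
    [&& t.1.1 \in A, t.1.2 \in B, t.2 \in B & t.1.1 + (t.2 - t.1.2) \notin A]].
  pose e := a - b.
  pose C := [set x + e | x in B]; pose B' := [set x in B | x + e \in A].
  have cardC : #|C| = #|B| by apply: card_imset; apply: addIr.
  have AC : A :&: C = [set x + e | x in B'].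
    apply/setP=> y; rewrite inE; apply/andP/imsetP.
      by case=> yA /imsetP[x xB Dy]; exists x; rewrite // inE xB -Dy.
    by case=> x; rewrite inE => /andP[xB xeA] ->; split=> //; apply: imset_f.
  have cardB' : #|A :&: C| = #|B'|.
    by rewrite AC; apply: card_imset; apply: addIr.
  have bB' : b \in B' by rewrite inE bB /e addrC subrK.
  have ltB'B : (#|B'| < m)%N.
    rewrite -cardB; apply: proper_card; apply/properP; split.
      by apply/subsetP=> x; rewrite inE => /andP[].
    by exists b'; rewrite // inE b'B /= /e addrCA.
  have AUC0 : A :|: C != set0 by apply/set0Pn; exists a; rewrite inE aA.
  have B'0 : B' != set0 by apply/set0Pn; exists b.
  have := IHm _ ltB'B B' erefl (A :|: C) AUC0 B'0.
  rewrite -cardB' cardsUI cardC cardB => /leq_trans; apply.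
  apply: subset_leq_card; apply/subsetP=> _ /imset2P[x y xAC yB' ->].
  move: yB'; rewrite inE => /andP[yB yeA].
  case/setUP: xAC => [xA | /imsetP[z zB ->]]; first exact: imset2_f.
  by rewrite -addrA (addrC e) addrC; apply: imset2_f.
case/set0Pn: (B0) => b bB.
(* A + B contains a translate of A, which suffices when #|B| = 1. *)
have leA : (#|A| <= #|[set (a + b)%R | a in A, b in B]|)%N.
  rewrite -(card_imset (mem A) (addIr b)); apply: subset_leq_card.
  by apply/subsetP=> _ /imsetP[x xA ->]; apply: imset2_f.
apply: leq_trans leA; rewrite geq_min.
have [m_le1 | m_gt1] := leqP m 1; apply/orP; [right | left]; first by lia.
rewrite -cardB in m_gt1; case/card_gt1P: m_gt1 => c [c' [cB c'B cc']].
rewrite (@translation_stable_full p p_pr A (c' - c)) //.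
- by rewrite cardsT card_Fp.
- by rewrite subr_eq0 eq_sym.
move=> x xA; apply: contraNT stabA => xA'; apply/existsP.
by exists (x, c, c'); rewrite /= xA cB c'B.
Qed.

(** The usual bound [minn p (1 + \sum_i (#|X i| - 1))], with [r] added to both
    sides to avoid truncated subtractions. *)
Lemma cauchy_davenport_iter p (p_pr : prime p) (r : nat)
    (X : nat -> {set 'F_p}) :
    (forall i, X i != set0) ->
  exists S : {set 'F_p},
    (minn (p + r) (\sum_(i < r) #|X i|).+1 <= #|S| + r)%N /\
    forall s, s \in S ->
      exists x : nat -> 'F_p, (forall i, i < r -> x i \in X i)%N /\
                              s = \sum_(i < r) x i.
Proof.
move=> X0; elim: r => [|r [S [cardS sumS]]].
  exists [set 0]; split; first by rewrite big_ord0 cards1 addn0 geq_minr.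
  by move=> s /set1P->; exists (fun=> 0); rewrite big_ord0.
exists [set (a + b)%R | a in S, b in X r]; split.
  have r_le : (r <= \sum_(i < r) #|X i|)%N.
    rewrite -[X in (X <= _)%N](card_ord r) -sum1_card leq_sum // => i _.
    by rewrite card_gt0.
  have p_gt0 := prime_gt0 p_pr.
  have S0 : S != set0 by rewrite -card_gt0; lia.
  have := cauchy_davenport p_pr S0 (X0 r).
  rewrite big_ord_recr /=; move: (X0 r); rewrite -card_gt0.
  move: cardS r_le.
  by move: (\sum_(i < r) _)%N #|S| #|X r| #|[set _ | _ in _, _ in _]|; lia.
move=> _ /imset2P[s b sS bX ->]; have [x [xX ->]] := sumS s sS.
exists (fun i => if i == r then b else x i); split=> [i|].
  by rewrite ltnS leq_eqVlt; case: eqP => [-> //|_ /=]; apply: xX.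
rewrite big_ord_recr /= eqxx; congr (_ + _); apply: eq_bigr => i _.
by rewrite ltn_eqF.
Qed.

(** * Sets of largest values *)

(** The index [k] stands for the rank [k + 1]: [X k] consists of [k + 1] points
    of [A] at which [f] is largest, and [v k] is the least of these values. *)
Lemma top_sets (R : realDomainType) (T : finType) (A : {set T}) (f : T -> R) :
  exists (X : 'I_#|A| -> {set T}) (v : 'I_#|A| -> R),
    [/\ forall k, #|X k| = k.+1, forall k, X k \subset A,
        forall k x, x \in X k -> v k <= f x &
        \sum_k v k = \sum_(a in A) f a].
Proof.
pose leT := relpre f (fun y z => z <= y); pose s := sort leT (enum A).
have sz_s : size s = #|A| by rewrite size_sort cardE.
have [A0|[a0 a0A]] := set_0Vmem A.
  have nok (k : 'I_#|A|) : False by case: k => k; rewrite A0 cards0.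
  exists (fun=> set0), (fun=> 0); split=> [k|k|k|]; try by case: (nok k).
  by rewrite [RHS]big_pred0 ?big1 // => x; rewrite A0 inE.
have s_sorted : sorted leT s by apply: sort_sorted => y z; apply: le_total.
have leT_refl : reflexive leT by move=> y; apply: lexx.
have leT_trans : transitive leT by move=> y z t zy yt; apply: le_trans yt zy.
have s_uniq : uniq s by rewrite sort_uniq enum_uniq.
have mem_s x : (x \in s) = (x \in A) by rewrite mem_sort mem_enum.
exists (fun k => [set x in take k.+1 s]), (fun k => f (nth a0 s k)); split.
- move=> k; rewrite cardsE; have /card_uniqP-> := take_uniq k.+1 s_uniq.
  by rewrite size_takel // sz_s.
- by move=> k; apply/subsetP=> x; rewrite inE => /mem_take; rewrite mem_s.
- move=> k x; rewrite inE => /(nthP a0)[i].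
  rewrite size_takel ?sz_s // => lti <-; rewrite nth_take //.
  apply: (sorted_leq_nth leT_trans leT_refl a0 s_sorted) => //.
    by rewrite inE sz_s (leq_trans lti).
  by rewrite inE sz_s.
rewrite -[RHS]big_enum /= -(perm_big _ (permEl (perm_sort leT (enum A)))) /=.
by rewrite (big_nth a0) sz_s big_mkord.
Qed.

Lemma exists_ge_mean (R : realDomainType) (m : nat) (F : 'I_m -> R) :
  (0 < m)%N -> exists k, \sum_i F i <= m%:R * F k.
Proof.
move=> m_gt0.
have [k _ maxk] :=
  @Order.TotalTheory.arg_maxP _ _ _ (Ordinal m_gt0) xpredT F isT.
exists k; rewrite mulr_natl -[X in _ *+ X](card_ord m) -sumr_const.
exact: ler_sum.
Qed.

(** * The property for prime moduli *)

(** [balanced R k A]: for all functions [f i], [i < k], with values in [R],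
    every residue class [n] modulo [q] is a sum of [k] elements [x i] of [A]
    such that the sum of the [f i (x i)] is at least the mean over [A] of the
    sum of the [f i]. The inequality is multiplied by the size of [A], so that
    no division occurs, and only the values of [f i] on [A] matter. *)
Definition balanced (R : realDomainType) (k q : nat) (A : {set 'I_q}) : Prop :=
  forall (f : 'I_k -> 'I_q -> R) (n : nat), exists x : 'I_k -> 'I_q,
    [/\ forall i, x i \in A,
        (\sum_(i < k) x i = n %[mod q])%N &
        \sum_(a in A) \sum_(i < k) f i a <= #|A|%:R * \sum_(i < k) f i (x i)].

Lemma sum_alternating_ranks (j m : nat) (k : 'I_m) :
  (\sum_(i < j.*2.+1) (if odd i then rev_ord k else k).+1 = j * m.+1 + k.+1)%N.
Proof.
elim: j => [|j IHj]; first by rewrite big_ord1.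
rewrite doubleS big_ord_recr big_ord_recr /= IHj /= odd_double /=.
by have := ltn_ord k; lia.
Qed.

(** The number of functions is odd, [2 j + 1]: those with an odd index get the
    rank opposite to [k], the others get [k]. The condition on the sizes is the
    one required by Cauchy-Davenport for the least favourable rank, the one with
    [k + 1 = 1]. *)
Lemma balanced_prime (R : realDomainType) p (p_pr : prime p) (j : nat)
    (A : {set 'I_p}) :
  (0 < #|A|)%N -> (p + j.*2 <= (j * #|A|.+1).+1)%N ->
  balanced R j.*2.+1 A.
Proof.
suff balF (B : {set 'F_p}) : (0 < #|B|)%N ->
    ((Zp_trunc (pdiv p)).+2 + j.*2 <= (j * #|B|.+1).+1)%N ->
    balanced R j.*2.+1 B.
  by move: A; case: _ / (Fp_cast p_pr).
have castP b : ((Zp_trunc (pdiv p)).+2 + j.*2 <= b)%N -> (p + j.*2 <= b)%N.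
  by rewrite Fp_cast.
move=> B_gt0 /castP B_large f n.
have /fin_all_exists[X /fin_all_exists[v Xv]] : forall i,
    exists (X : 'I_#|B| -> {set 'F_p}) (v : 'I_#|B| -> R),
    [/\ forall k, #|X k| = k.+1, forall k, X k \subset B,
        forall k x, x \in X k -> v k <= f i x &
        \sum_k v k = \sum_(a in B) f i a].
  by move=> i; apply: top_sets.
(* For each i, the rank rk i k runs over all ranks when k does. *)
pose rk (i : nat) (k : 'I_#|B|) := if odd i then rev_ord k else k.
have sumv : \sum_k \sum_i v i (rk i k) = \sum_(a in B) \sum_i f i a.
  rewrite exchange_big [RHS]exchange_big /=; apply: eq_bigr => i _.
  have [_ _ _ Dv] := Xv i; rewrite -Dv /rk; case: (odd i) => //.
  by rewrite [RHS](reindex_inj rev_ord_inj).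
have [k lek] := exists_ge_mean (fun k => \sum_i v i (rk i k)) B_gt0.
(* inord i is i for the indices i < 2 j + 1 that occur in the sums below. *)
pose Y (i : nat) := X (inord i) (rk i k).
have Y0 i : Y i != set0.
  by rewrite -card_gt0 /Y; have [-> _ _ _] := Xv (inord i).
have [S [cardS sumS]] := cauchy_davenport_iter p_pr j.*2.+1 Y0.
have sumY : (\sum_(i < j.*2.+1) #|Y i| = j * #|B|.+1 + k.+1)%N.
  rewrite -sum_alternating_ranks; apply: eq_bigr => i _.
  by rewrite /Y inord_val; have [-> _ _ _] := Xv i.
have nS : n%:R \in S.
  suff -> : S = [set: 'F_p] by rewrite inE.
  apply/eqP; rewrite eqEcard subsetT cardsT card_Fp //=.
  by move: B_large cardS; rewrite sumY; move: (j * _)%N #|S| => t c; lia.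
have [x [xY Dn]] := sumS _ nS.
have xX (i : 'I_j.*2.+1) : x i \in X i (rk i k).
  by have := xY i (ltn_ord i); rewrite /Y inord_val.
exists (fun i => x i); split=> [i||].
- by have [_ /(_ (rk i k))/subsetP sub _ _] := Xv i; apply: sub.
- have : n%:R = (\sum_(i < j.*2.+1) x i)%N%:R :> 'F_p.
    by rewrite Dn natr_sum; apply: eq_bigr => i _; rewrite natr_Zp.
  by rewrite !Zp_nat => /(congr1 val) /= ->.
rewrite -sumv; apply: le_trans lek _; rewrite ler_wpM2l // ler_sum // => i _.
by have [_ _ /(_ _ _ (xX i)) le_v _] := Xv i.
Qed.

(** * Cubic residues *)

Lemma cubic_residuesP (q : nat) (a : 'I_q) :
  reflect (exists2 b : nat, coprime b q & a = b ^ 3 %[mod q])%N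
          (a \in cubic_residues q).
Proof.
rewrite inE; apply: (iffP existsP) => [[b /andP[]]|[b cobq Da]].
  by rewrite inE => cobq /eqP Da; exists b.
have q_gt0 : (0 < q)%N := leq_ltn_trans (leq0n a) (ltn_ord a).
exists (Ordinal (ltn_pmod b q_gt0)).
by rewrite inE /= coprime_modl cobq modnXm Da eqxx.
Qed.

Lemma mem_cubic_residues_mul (p r : nat)
    (a : 'I_(p * r)) (b : 'I_p) (c : 'I_r) :
    coprime p r -> (a = b %[mod p])%N -> (a = c %[mod r])%N ->
  (a \in cubic_residues (p * r)) =
  (b \in cubic_residues p) && (c \in cubic_residues r).
Proof.
move=> copr ab ac; apply/cubic_residuesP/andP.
  case=> t; rewrite coprimeMr => /andP[cotp cotr] /eqP.
  rewrite chinese_remainder // => /andP[/eqP Dp /eqP Dr].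
  by split; apply/cubic_residuesP; exists t; rewrite // -?ab -?ac.
case=> /cubic_residuesP[t cot Dt] /cubic_residuesP[u cou Du].
exists (chinese p r t u).
  rewrite coprimeMr -coprime_modl chinese_modl // coprime_modl cot.
  by rewrite -coprime_modl chinese_modr // coprime_modl cou.
apply/eqP; rewrite chinese_remainder //.
rewrite -!(modnXm 3 _ (chinese p r t u)) chinese_modl // chinese_modr //.
by rewrite !modnXm ab ac Dt Du !eqxx.
Qed.

Lemma card_Zq_units (q : nat) : #|Zq_units q| = totient q.
Proof.
rewrite totient_count_coprime big_mkord -sum1_card big_mkcond /=.
by apply: eq_bigr => i _; rewrite inE coprime_sym; case: coprime.
Qed.

(** If [3 u = 1] modulo [totient q] then [b] is the cube of [b ^ u]. *)
Lemma units_sub_cubic_residues (q : nat) :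
  coprime 3 (totient q) -> Zq_units q \subset cubic_residues q.
Proof.
move=> co3q; apply/subsetP=> b; rewrite inE => cobq; apply/cubic_residuesP.
case: (@egcdnP 3 (totient q) isT) => u v Duv _.
exists (b ^ u)%N; first exact: coprimeXl.
rewrite -expnM Duv (eqP co3q) expnD expn1 expnM.
by rewrite -modnMml Euler_exp_totient ?coprimeXl // modnMml mul1n.
Qed.

Lemma card_cubic_residues_ge (p : nat) :
  prime p -> (p.-1 <= 3 * #|cubic_residues p|)%N.
Proof.
move=> p_pr; have FpE := Fp_cast p_pr.
(* Writing the modulus as (Zp_trunc (pdiv p)).+2, which equals p, makes the
   type of residues that of the elements of the field 'F_p. *)
case: _ / FpE.
have coFp t : coprime t (Zp_trunc (pdiv p)).+2 = coprime t p by rewrite Fp_cast.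
pose cube (x : 'F_p) := x ^+ 3; pose U : {set 'F_p} := [set~ 0].
have cubeU : cube @: U \subset cubic_residues (Zp_trunc (pdiv p)).+2.
  apply/subsetP=> _ /imsetP[x xU ->]; apply/cubic_residuesP.
  exists (val x).
    by rewrite coFp coprime_sym -unitFpE // natr_Zp unitfE; rewrite !inE in xU.
  by rewrite /cube -{1}(natr_Zp x) -natrX Zp_nat /= modn_mod.
have fiber y : (#|[set x in U | cube x == y]| <= 3)%N.
  rewrite cardE -ltnS -[4%N](size_XnsubC y (isT : 0 < 3)%N).
  apply: max_poly_roots; rewrite ?enum_uniq //.
    by rewrite -size_poly_gt0 size_XnsubC.
  apply/allP=> x; rewrite mem_enum inE => /andP[_ /eqP <-].
  by rewrite rootE !hornerE subrr.
have cardU : #|U| = (Zp_trunc (pdiv p)).+2.-1 by rewrite cardsC1 card_ord.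
rewrite -cardU; apply: leq_trans (_ : 3 * #|cube @: U| <= _)%N; last first.
  by rewrite leq_mul2l subset_leq_card.
rewrite -sum1_card.
rewrite (partition_big cube [in cube @: U]) /= => [|x xU]; last first.
  exact: imset_f.
rewrite mulnC -sum_nat_const; apply: leq_sum => y _.
by rewrite sum1dep_card.
Qed.

(** For the other primes the bound fails: the sets of cubic residues modulo 2
    and 7 are {1} and {1, 6}. *)
Lemma card_cubic_residues_large (p : nat) :
  prime p -> coprime p 14 -> (p + 3 <= 4 * #|cubic_residues p|)%N.
Proof.
move=> p_pr cop14.
have [p_lt|p_ge] := ltnP p 13; last first.
  by have := card_cubic_residues_ge p_pr; lia.
have : coprime 3 (totient p) /\ (2 < p)%N.
  rewrite totient_prime //.
  by move: p_pr cop14 p_lt; do 13! [case: p => [//|p]].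
case=> /units_sub_cubic_residues/subset_leq_card.
rewrite card_Zq_units totient_prime //; lia.
Qed.

(** * Products of coprime moduli *)

Lemma sum_cubic_residues_mul (V : nmodType) (p r : nat) (g : 'I_(p * r) -> V)
    (c : 'I_p -> 'I_r -> 'I_(p * r)) :
    coprime p r ->
    (forall a b, c a b = a %[mod p])%N -> (forall a b, c a b = b %[mod r])%N ->
  \sum_(a in cubic_residues (p * r)) g a =
  \sum_(a in cubic_residues p) \sum_(b in cubic_residues r) g (c a b).
Proof.
move=> copr cp cr; rewrite pair_big /=.
have [/eqP|] := posnP (p * r); last rewrite muln_gt0 => /andP[p_gt0 r_gt0].
  rewrite muln_eq0 => pr0; rewrite !big_pred0 // => [[a b]|a].
    by case/orP: pr0 => /eqP pr0; [case: a | case: b] => n; rewrite pr0.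
  by case: a => n; case/orP: pr0 => /eqP ->; rewrite ?muln0.
pose h (a : 'I_(p * r)) :=
  (Ordinal (ltn_pmod a p_gt0), Ordinal (ltn_pmod a r_gt0)).
rewrite (reindex (fun u => c u.1 u.2)) /=.
  by apply: eq_bigl => -[a b] /=; apply: mem_cubic_residues_mul.
exists h => [[a b]|a] _.
  by congr (_, _); apply: val_inj; rewrite /= ?cp ?cr modn_small.
apply: val_inj.
rewrite -[LHS](modn_small (ltn_ord _)) -[RHS](modn_small (ltn_ord _)).
by apply/eqP; rewrite chinese_remainder // cp cr !modn_mod !eqxx.
Qed.

Lemma balanced_mul (R : realDomainType) (k p r : nat) :
    (0 < p)%N -> (0 < r)%N -> coprime p r ->
    balanced R k (cubic_residues p) -> balanced R k (cubic_residues r) ->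
  balanced R k (cubic_residues (p * r)).
Proof.
move=> p_gt0 r_gt0 copr balp balr f n.
have pr_gt0 : (0 < p * r)%N by rewrite muln_gt0 p_gt0.
pose c (a : 'I_p) (b : 'I_r) := Ordinal (ltn_pmod (chinese p r a b) pr_gt0).
have cp a b : (c a b = a %[mod p])%N.
  by rewrite /= modn_dvdm ?dvdn_mulr // chinese_modl.
have cr a b : (c a b = b %[mod r])%N.
  by rewrite /= modn_dvdm ?dvdn_mull // chinese_modr.
have modS s (F G : 'I_k -> nat) : (forall i, F i = G i %[mod s])%N ->
    (\sum_i F i = \sum_i G i %[mod s])%N.
  by move=> FG; rewrite -modn_summ (eq_bigr _ (fun i _ => FG i)) modn_summ.
have [x [xA xn lex]] :=
  balp (fun i a => \sum_(b in cubic_residues r) f i (c a b)) n.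
have [y [yA yn ley]] := balr (fun i b => f i (c (x i) b)) n.
exists (fun i => c (x i) (y i)); split.
- by move=> i; rewrite (mem_cubic_residues_mul copr (cp _ _) (cr _ _)) xA yA.
- apply/eqP; rewrite chinese_remainder // -xn -yn.
  rewrite (modS _ _ _ (fun i => cp _ _)) (modS _ _ _ (fun i => cr _ _)).
  by rewrite !eqxx.
have card_mul :
    #|cubic_residues (p * r)| = (#|cubic_residues p| * #|cubic_residues r|)%N.
  rewrite -sum_nat_const -!sum1_card.
  exact: (sum_cubic_residues_mul (fun=> 1%N) copr cp cr).
rewrite (sum_cubic_residues_mul _ copr cp cr) card_mul natrM -mulrA.
apply: le_trans (ler_wpM2l (ler0n _ _) ley).
apply: le_trans (le_trans lex _).
  by apply: ler_sum => a _; rewrite exchange_big.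
by rewrite ler_wpM2l // exchange_big.
Qed.

(** * Square-free moduli *)

Lemma balanced1 (R : realDomainType) (k : nat) :
  balanced R k (cubic_residues 1).
Proof.
move=> f n; exists (fun=> ord0); split=> [i||].
- by apply/cubic_residuesP; exists 1%N.
- by rewrite !modn1.
rewrite mulr_natl -sumr_const; apply: ler_sum => a _.
by apply: ler_sum => i _; rewrite ord1.
Qed.

Lemma balanced_cubic_residues (R : realDomainType) (q : nat) :
    (0 < q)%N -> squarefree q -> coprime q 14 ->
  balanced R 9 (cubic_residues q).
Proof.
elim/ltn_ind: q => q IHq q_gt0 q_sqfree q_14.
have [q_le1|q_gt1] := leqP q 1.
  have -> : q = 1%N by lia.
  exact: balanced1.
have p_pr := pdiv_prime q_gt1; have p_dvd := pdiv_dvd q.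
move: (pdiv q) p_pr p_dvd => p p_pr /dvdnP[r Dq]; rewrite mulnC in Dq; subst q.
have p_gt1 := prime_gt1 p_pr.
move: q_gt0 q_14; rewrite muln_gt0 coprimeMl.
move=> /andP[p_gt0 r_gt0] /andP[p_14 r_14].
have copr : coprime p r.
  rewrite prime_coprime //; apply/negP=> /dvdnP[s Dr].
  have := q_sqfree p; rewrite Dr mulnCA dvdn_mull // => /(_ isT); lia.
apply: balanced_mul => //.
  have A_large := card_cubic_residues_large p_pr p_14.
  by apply: (@balanced_prime R p p_pr 4); move: A_large; move: #|_| => m; lia.
apply: IHq => //; first by rewrite ltn_Pmull.
by move=> d dr; apply: q_sqfree; apply: dvdn_mull.
Qed.

Theorem theorem1p3 (R : realType) (q : nat) (q_gt0 : (0 < q)%N)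
    (q_sqfree : squarefree q) (q_14 : coprime q 14)
    (f : 'I_9 -> {a : 'I_q | a \in cubic_residues q} -> R) (n : 'I_q) :
  exists x : 'I_9 -> {a : 'I_q | a \in cubic_residues q},
    (n = \sum_(i < 9) val (val (x i)) %[mod q])%N /\
    \sum_(i < 9) f i (x i) >=
      (phi3 q)%:R^-1 *
      \sum_(a : {a : 'I_q | a \in cubic_residues q}) \sum_(i < 9) f i a.
Proof.
(* Extension by 0 outside the cubic residues. *)
pose g i a := oapp (f i) 0 (insub a).
have gE i s : g i (val s) = f i s by rewrite /g valK.
have [x [xA xn lex]] := balanced_cubic_residues q_gt0 q_sqfree q_14 g n.
pose y i : {a : 'I_q | a \in cubic_residues q} := Sub (x i) (xA i).
exists y; split; first by rewrite -xn.
have phi_gt0 : 0 < (phi3 q)%:R :> R.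
  by rewrite ltr0n; apply/card_gt0P; exists (x ord0).
rewrite ler_pdivrMl // -(eq_bigr _ (fun i _ => gE i (y i))).
apply: le_trans lex; rewrite [leRHS]big_sub.
by apply: ler_sum => a _; apply: ler_sum => i _; rewrite gE.
Qed.
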